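(* Let $s \in \mathbb{R}$ and let $Y_s$ be a real random variable whose quantile function is $Q(p;s) = \mathrm{Li}_s(p)$. Then the support of the distribution of $Y_s$ is $$\mathrm{supp}(Y_s) = \begin{cases} [0,\zeta(s)], & \text{if } s > 1, \\ [0,\infty), & \text{if } s \le 1. \end{cases}$$
   Context: For $s \in \mathbb{R}$ and $p \in [0,1]$, the polylogarithm is $\mathrm{Li}_s(p) = \sum_{k=1}^{\infty} \frac{p^k}{k^s}$; the series converges except when $p = 1$ and $s \le 1$, in which case the value is taken to be $+\infty$ (the limit as $p \to 1^-$). The quantile function of a random variable is its inverse cumulative distribution function $Q = F^{-1}$; that $Y_s$ has quantile function $\mathrm{Li}_s$ means that $Y_s$ has the same distribution as $\mathrm{Li}_s(X)$, where $X$ is uniformly distributed on $[0,1]$. $\zeta$ denotes the Riemann zeta function. The support of a distribution on $\mathbb{R}$ is the smallest closed set of probability one. *)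

(* Defs.v *)
From HB Require Import structures.
From mathcomp Require Import all_boot all_order all_algebra.
From mathcomp Require Import all_classical all_reals all_analysis measurable_realfun.
Set Implicit Arguments.
Unset Strict Implicit.
Unset Printing Implicit Defensive.
Import Order.TTheory GRing.Theory Num.Theory.
Import numFieldNormedType.Exports.
Local Open Scope classical_set_scope.
Local Open Scope ring_scope.

(* Meant for 0 <= p <= 1: the terms are then nonnegative, so that the sum always
   exists in \bar R, and it is +oo exactly when p = 1 and s <= 1. *)
Definition polylog (R : realType) (s p : R) : \bar R :=
  (\sum_(1 <= k <oo) (p ^+ k / k%:R `^ s)%:E)%E.

(* Meant for 1 < s, where the Dirichlet series converges. *)
Definition zeta (R : realType) (s : R) : R :=
  limn (fun n => \sum_(1 <= k < n) (k%:R `^ s)^-1).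

(* Y has the same distribution as Q(X), with X uniform on [0, 1]. As Q may take
   the value +oo, the two laws are compared on the Borel sets of \bar R; only
   the values of Q on [0, 1] matter. *)
Definition has_quantile_function (R : realType) (d : measure_display)
    (T : measurableType d) (P : probability T R) (Y : {RV P >-> R})
    (Q : R -> \bar R) : Prop :=
  forall B : set (\bar R), measurable B ->
    P [set t | B (Y t)%:E] = uniform_prob (@ltr01 R) (`[0, 1] `&` Q @^-1` B).

Definition is_support (R : realType) (mu : set R -> \bar R) (S : set R) : Prop :=
  [/\ closed S, mu S = 1%E &
      forall C : set R, closed C -> mu C = 1%E -> S `<=` C].

(* Main.v *)
Require Import Defs.
From HB Require Import structures.
From mathcomp Require Import all_boot all_order all_algebra.
From mathcomp Require Import all_classical all_reals all_analysis measurable_realfun.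
From mathcomp Require Import ring lra.
Import Order.TTheory GRing.Theory Num.Theory.
Import numFieldNormedType.Exports.
Local Open Scope classical_set_scope.
Local Open Scope ring_scope.

(** When a quantile function is continuous on [0, 1), the support of the law is
the closure of the image of [0, 1); and [polylog s] is continuous there, and
increases from 0 towards its value at 1.

Everything about continuity comes from convexity: each [p ^+ k] is convex and
the weights are nonnegative, so [polylog s] is convex ([polylog_chord]); it is
finite below 1 because powers of [k] are dominated by geometric progressions
([polylog_fin_num]); a finite convex nondecreasing function is Lipschitz on
[0, r] for each [r < 1] ([polylog_lipschitz]).

As the supremum over [p < 1] is the value at 1 ([polylog_lt_exists]), the
intermediate value theorem shows that every [y >= 0] below [polylog s 1] is a
value on [0, 1) ([polylog_onto]). The value at 1 is the zeta value for
[1 < s], by condensation ([dirichlet_sum_le]), and infinite otherwise, by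
comparison with the harmonic series ([polylog1_pinfty]).

On the probabilistic side, a closed set of probability one contains all values
taken on [0, 1) ([quantile_support]), hence everything in the claimed support
except possibly the end point, which it contains by closedness. Conversely the
claimed support contains these values, and [0, 1) has uniform probability 1
([uniform_prob_co]). *)

(** * Sign, monotonicity and convexity of the polylogarithm *)

Lemma polylog_term_ge0 {R : realType} (s : R) {p : R} k :
  0 <= p -> 0 <= p ^+ k / k%:R `^ s.
Proof. by move=> p0; rewrite divr_ge0 ?exprn_ge0 ?powR_ge0. Qed.

Lemma polylog_ge0 {R : realType} (s : R) {p : R} : 0 <= p -> (0 <= polylog s p)%E.
Proof.
by move=> p0; apply: nneseries_ge0 => k _ _; rewrite lee_fin polylog_term_ge0.
Qed.

Lemma polylog0 {R : realType} (s : R) : polylog s 0 = 0%E.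
Proof. by apply: eseries0 => -[|k]// _ _; rewrite expr0n mul0r. Qed.

Lemma polylog_le {R : realType} (s : R) {p q : R} :
  0 <= p -> p <= q -> (polylog s p <= polylog s q)%E.
Proof.
move=> p0 pq; apply: lee_nneseries => k => [_ _|_]; rewrite lee_fin.
  exact: polylog_term_ge0.
by rewrite ler_wpM2r ?invr_ge0 ?powR_ge0// lerXn2r// nnegrE (le_trans p0).
Qed.

(** Convexity of the monomial [x ^+ k] on the nonnegative half-line, with the
denominator of the chord cleared. *)
Lemma exprn_chord {R : realDomainType} {a b r : R} k :
  0 <= a -> a <= b -> b <= r ->
  (r - a) * b ^+ k <= (r - b) * a ^+ k + (b - a) * r ^+ k.
Proof.
move=> a0 ab br; elim: k => [|k IH]; first by rewrite !expr0; lra.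
have ak : a ^+ k <= r ^+ k by rewrite lerXn2r// ?nnegrE; lra.
rewrite !exprS.
have : 0 <= (r - b) * (b - a) * (r ^+ k - a ^+ k).
  by rewrite mulr_ge0 ?mulr_ge0 ?subr_ge0.
have : 0 <= b * ((r - b) * a ^+ k + (b - a) * r ^+ k - (r - a) * b ^+ k).
  by rewrite mulr_ge0 ?subr_ge0 //; lra.
lra.
Qed.

(** A sum of convex functions with nonnegative weights is convex. In the
extended reals this is a termwise comparison of series; finiteness comes later. *)
Lemma polylog_chord {R : realType} (s : R) {a b r : R} :
  0 <= a -> a <= b -> b <= r ->
  ((r - a)%:E * polylog s b <=
   (r - b)%:E * polylog s a + (b - a)%:E * polylog s r)%E.
Proof.
move=> a0 ab br; have b0 := le_trans a0 ab; have r0 := le_trans b0 br.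
have t0 p k : 0 <= p -> (0 <= (p ^+ k / k%:R `^ s)%:E)%E.
  by move=> p0; rewrite lee_fin polylog_term_ge0.
have scale c p : 0 <= p -> (c%:E * polylog s p =
    \sum_(1 <= k <oo) c%:E * (p ^+ k / k%:R `^ s)%:E)%E.
  by move=> p0; rewrite nneseriesZl// => k _; exact: t0.
rewrite !scale// -nneseriesD => [|k _ _|k _ _]; last 2 first.
- by rewrite mule_ge0 ?t0// lee_fin subr_ge0.
- by rewrite mule_ge0 ?t0// lee_fin subr_ge0.
apply: lee_nneseries => k => [_ _|_].
  by rewrite mule_ge0 ?t0// lee_fin subr_ge0 (le_trans ab).
rewrite -!EFinM -EFinD lee_fin !mulrA -mulrDl ler_wpM2r ?invr_ge0 ?powR_ge0//.
exact: exprn_chord.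
Qed.

(** * Bounds on partial sums of nonnegative series *)

Lemma nneseries_le_bound {R : realType} (u : R ^nat) (M : R) :
  (forall k, 0 <= u k) -> (forall n, \sum_(1 <= k < n) u k <= M) ->
  (\sum_(1 <= k <oo) (u k)%:E <= M%:E)%E.
Proof.
move=> u0 uM; apply: lime_le.
  by apply: is_cvg_nneseries => k _ _; rewrite lee_fin.
by apply: nearW => n; rewrite sumEFin lee_fin.
Qed.

Lemma nneseries_fin_bound {R : realType} (u : R ^nat) :
  (forall k, 0 <= u k) -> (\sum_(1 <= k <oo) (u k)%:E < +oo)%E ->
  exists M, forall n, \sum_(1 <= k < n) u k <= M.
Proof.
move=> u0 ulty; exists (fine (\sum_(1 <= k <oo) (u k)%:E)%E) => n.
rewrite -lee_fin fineK; last first.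
  by rewrite ge0_fin_numE// nneseries_ge0// => k _ _; rewrite lee_fin.
by rewrite -sumEFin; apply: nneseries_lim_ge => k _ _; rewrite lee_fin.
Qed.

Lemma geometric_sum_le {R : realFieldType} (q : R) n :
  0 <= q -> q < 1 -> \sum_(0 <= k < n) q ^+ k <= (1 - q)^-1.
Proof.
move=> q0 q1; have q10 : 0 < 1 - q by rewrite subr_gt0.
rewrite -[leLHS]mul1r -[X in X * _](mulVf (lt0r_neq0 q10)) -mulrA.
rewrite -[leRHS]mulr1 ler_wpM2l ?invr_ge0 ?(ltW q10)//.
by rewrite big_mkord -opprB mulNr -subrX1 opprB lerBlDr lerDl exprn_ge0.
Qed.

(** * Convergence of the polylogarithm below 1 *)

(** The logarithm grows slower than any linear function, so a power of [k]
grows slower than any geometric progression. *)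
Lemma powRN_le_expR {R : realType} (s : R) {e : R} : 0 < e ->
  exists2 C : R, 0 <= C & forall k, (0 < k)%N -> (k%:R `^ s)^-1 <= C * expR e ^+ k.
Proof.
(* m is a positive upper bound of - s. *)
move=> e0; pose m := `|s| + 1; have m0 : 0 < m by rewrite ltr_wpDl.
have em : 0 < e / m by rewrite divr_gt0.
exists (expR (- m * ln (e / m))) => [|k k0]; first exact: expR_ge0.
have k0' : 0 < k%:R :> R by rewrite ltr0n.
rewrite -powRN -expRM_natl -expRD /powR gt_eqF// ler_expR.
have lnk : ln (k%:R : R) <= k%:R * (e / m) - ln (e / m).
  rewrite lerBrDr -lnM ?posrE//.
  by apply/ltW/ln_sublinear; rewrite mulr_gt0.
have lnk0 : 0 <= ln (k%:R : R) by rewrite ln_ge0// ler1n.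
have : - s * ln k%:R <= m * ln k%:R.
  by rewrite ler_wpM2r// (le_trans (ler_norm _))// normrN lerDl.
have : m * ln k%:R <= m * (k%:R * (e / m) - ln (e / m)) by rewrite ler_wpM2l// ltW.
have -> : m * (k%:R * (e / m) - ln (e / m)) = - m * ln (e / m) + k%:R * e.
  by field; rewrite gt_eqF.
lra.
Qed.

(** With [p <= x < q < 1], the general term at [x] is dominated by a multiple of
[q ^+ k]: the factor [(q / x) ^+ k] absorbs the power of [k]. The point [x] is
there only to have a nonzero denominator when [p = 0]. *)
Lemma polylog_fin_num {R : realType} (s : R) {p : R} :
  0 <= p -> p < 1 -> polylog s p \is a fin_num.
Proof.
move=> p0 p1; rewrite ge0_fin_numE ?polylog_ge0//.
pose x := (1 + p) / 2; have x0 : 0 < x by rewrite /x; lra.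
have x1 : x < 1 by rewrite /x; lra.
apply: (le_lt_trans (polylog_le s p0 (_ : p <= x))); first by rewrite /x; lra.
pose q := (1 + x) / 2; have q0 : 0 < q by rewrite /q; lra.
have q1 : q < 1 by rewrite /q; lra.
have e0 : 0 < ln (q / x).
  by rewrite ln_gt0// ltr_pdivlMr// mul1r /q; lra.
have [C C0 HC] := powRN_le_expR s e0.
apply: (@le_lt_trans _ _ (C * (1 - q)^-1)%:E); last exact: ltry.
apply: nneseries_le_bound => [k|n]; first by rewrite polylog_term_ge0// ltW.
apply: (@le_trans _ _ (\sum_(0 <= k < n) C * q ^+ k)); last first.
  by rewrite -mulr_sumr ler_wpM2l// geometric_sum_le// ltW.
case: n => [|n]; first by rewrite !big_geq.
rewrite [leRHS]big_ltn// -[leLHS]add0r lerD ?mulr_ge0 ?exprn_ge0 ?(ltW q0)//.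
rewrite big_seq [leRHS]big_seq ler_sum// => k; rewrite mem_index_iota => /andP[k0 _].
rewrite (le_trans (ler_wpM2l _ (HC k k0))) ?exprn_ge0 ?(ltW x0)//.
rewrite lnK ?posrE ?(divr_gt0 q0 x0)// mulrCA -exprMn.
by rewrite [x * _]mulrC divfK// gt_eqF.
Qed.

(** * The value at 1 *)

Lemma polylog1E {R : realType} (s : R) :
  polylog s 1 = (\sum_(1 <= k <oo) ((k%:R `^ s)^-1)%:E)%E.
Proof. by apply: eq_eseriesr => k _; rewrite expr1n mul1r. Qed.

(** Comparison with the harmonic series. *)
Lemma polylog1_pinfty {R : realType} (s : R) : s <= 1 -> polylog s 1 = +oo%E.
Proof.
move=> s1; apply/eqP; rewrite -leye_eq leNgt polylog1E; apply/negP => lty.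
have [|M HM] := nneseries_fin_bound _ _ lty.
  by move=> k; rewrite invr_ge0 powR_ge0.
apply: (@dvg_harmonic R); apply: nondecreasing_is_cvgn.
  by apply: nondecreasing_series => k _ _; exact: harmonic_ge0.
exists M => _ [n _ <-]; apply: le_trans (HM n.+1).
rewrite /series/= big_add1/= ler_sum// => k _.
rewrite lef_pV2 ?posrE ?powR_gt0//.
by rewrite -[leRHS]powRr1// ler_powR// ler1n.
Qed.

(** Cauchy condensation: the [2 ^ j] terms with [2 ^ j <= k < 2 ^ j.+1] are each
at most [(2 ^ j) `^ - s], so together at most the [j]-th power of
[2 / 2 `^ s], which is less than 1. *)
Lemma dirichlet_sum_le {R : realType} (s : R) n : 1 < s ->
  \sum_(1 <= k < n) (k%:R `^ s)^-1 <= (1 - 2 / 2 `^ s)^-1.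
Proof.
move=> s1; have s0 : 0 <= s by lra.
have p0 k : 0 <= (k%:R `^ s)^-1 :> R by rewrite invr_ge0 powR_ge0.
have q0 : 0 <= 2 / 2 `^ s :> R by rewrite divr_ge0 ?powR_ge0.
have q1 : 2 / 2 `^ s < 1 :> R.
  rewrite ltr_pdivrMr ?powR_gt0// mul1r /powR gt_eqF// -[ltLHS]lnK ?posrE//.
  by rewrite ltr_expR ltr_pMl// ln_gt0// ltr1n.
apply: le_trans (geometric_sum_le _ n q0 q1).
apply: (@le_trans _ _ (\sum_(1 <= k < 2 ^ n) (k%:R `^ s)^-1)).
  (* n <= 2 ^ n, and the terms are nonnegative. *)
  case: n => [|n]; first by rewrite big_geq// sumr_ge0.
  rewrite [leRHS](@big_cat_nat _ _ _ n.+1)//=; last exact/ltnW/ltn_expl.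
  by rewrite lerDl sumr_ge0.
elim: n => [|n IH]; first by rewrite !big_geq.
rewrite (@big_cat_nat _ _ _ (2 ^ n))//= ?expn_gt0 ?leq_exp2l//.
rewrite [leRHS]big_nat_recr//= lerD//.
apply: (@le_trans _ _ (\sum_(2 ^ n <= k < 2 ^ n.+1) ((2 ^ n)%:R `^ s)^-1)).
  rewrite big_seq [leRHS]big_seq ler_sum// => k; rewrite mem_index_iota => /andP[nk _].
  have n0 : (0 < 2 ^ n)%N by rewrite expn_gt0.
  rewrite lef_pV2 ?posrE ?powR_gt0 ?ltr0n ?(leq_trans n0)//.
  by rewrite ge0_ler_powR ?nnegrE// ler_nat.
rewrite big_const_nat iter_addr_0 expnS mul2n -addnn addnK.
rewrite -[_ *+ _]mulr_natl !natrX -[in X in X `^ s]powR_mulrn//.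
rewrite -powRrM [_ * s]mulrC powRrM.
by rewrite powR_mulrn ?powR_ge0// -expr_div_n.
Qed.

Lemma polylog1_zeta {R : realType} (s : R) : 1 < s -> polylog s 1 = (zeta s)%:E.
Proof.
move=> s1; rewrite polylog1E /zeta -EFin_lim.
  by congr (limn _); apply/funext => n /=; rewrite sumEFin.
have p0 k : 0 <= (k%:R `^ s)^-1 :> R by rewrite invr_ge0 powR_ge0.
apply: nondecreasing_is_cvgn.
  apply/nondecreasing_seqP => -[|n]; first by rewrite !big_geq.
  by rewrite [leRHS]big_nat_recr//= lerDl.
by exists (1 - 2 / 2 `^ s)^-1 => _ [n _ <-]; exact: dirichlet_sum_le.
Qed.

(** * Continuity and range on [0, 1) *)

(** The part of Abel's theorem on nonnegative series that is needed here: a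
partial sum at 1 that exceeds [y] still does so just before 1, being a
polynomial. *)
Lemma polylog_lt_exists {R : realType} (s y : R) : (y%:E < polylog s 1)%E ->
  exists p, [/\ 0 <= p, p < 1 & (y%:E < polylog s p)%E].
Proof.
move=> yQ.
have [n yn] : exists n, y < \sum_(1 <= k < n) 1 ^+ k / k%:R `^ s.
  apply/not_existsP => H; move: yQ; apply/negP; rewrite -leNgt.
  apply: nneseries_le_bound => [k|n]; first exact: polylog_term_ge0.
  by rewrite leNgt; apply/negP.
pose f p := \sum_(1 <= k < n) p ^+ k / k%:R `^ s.
have cf : f p @[p --> 1^'-] --> f 1.
  apply: cvg_at_left_filter; apply: cvg_big => [|k _]; first exact: add_continuous.
  apply: cvgM; [exact: exprn_continuous|exact: cvg_cst].
have : \forall p \near 1^'-, y < f p by apply: (cvgr_gt _ cf).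
move=> yf; near (1:R)^'- => p.
have p0 : 0 <= p by near: p; apply: nbhs_left_ge.
exists p; split => //.
apply: (@lt_le_trans _ _ (f p)%:E); first by rewrite lte_fin; near: p.
rewrite -sumEFin; apply: nneseries_lim_ge => k _ _.
by rewrite lee_fin polylog_term_ge0.
Unshelve. all: by end_near. Qed.

(** By convexity, the slope on [a, b] is at most the slope on [b, t] for any
[t > r]; as the function is nonnegative and [b <= r], this is at most its value
at [t] divided by [t - r], which is finite when [t < 1]. *)
Lemma polylog_lipschitz {R : realType} (s r : R) : 0 <= r -> r < 1 ->
  exists2 L : R, 0 <= L & forall a b, 0 <= a -> a <= b -> b <= r ->
  fine (polylog s b) - fine (polylog s a) <= L * (b - a).
Proof.
move=> r0 r1; pose t := (1 + r) / 2.
have rt : r < t by rewrite /t; lra.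
have t1 : t < 1 by rewrite /t; lra.
have t0 : 0 <= t := le_trans r0 (ltW rt).
exists (fine (polylog s t) / (t - r)) => [|a b a0 ab br].
  by rewrite divr_ge0 ?fine_ge0 ?polylog_ge0// subr_ge0 ltW.
have := polylog_chord s a0 ab (le_trans br (ltW rt)).
have b0 := le_trans a0 ab; have b1 := le_lt_trans br r1.
have finE p : 0 <= p -> p < 1 -> exists2 u, polylog s p = u%:E & 0 <= u.
  move=> p0 p1; exists (fine (polylog s p)).
    by rewrite fineK ?polylog_fin_num.
  by rewrite fine_ge0 ?polylog_ge0.
have [u uE u0] := finE a a0 (le_lt_trans ab b1).
have [v vE v0] := finE b b0 b1.
have [w wE w0] := finE t t0 t1.
rewrite uE vE wE /= -!EFinM -EFinD lee_fin => chord.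
have uv : u <= v by rewrite -lee_fin -uE -vE polylog_le.
rewrite mulrAC ler_pdivlMr ?subr_gt0//.
have : 0 <= (v - u) * (r - b) by rewrite mulr_ge0 ?subr_ge0.
have : 0 <= (b - a) * v by rewrite mulr_ge0 ?subr_ge0.
lra.
Qed.

Lemma polylog_continuous {R : realType} (s r : R) : 0 <= r -> r < 1 ->
  {within `[0, r], continuous (fun p => fine (polylog s p))}.
Proof.
move=> r0 r1; have [L L0 HL] := polylog_lipschitz s r r0 r1.
apply/subspace_continuousP => x /=; rewrite in_itv/= => /andP[x0 xr].
have HL' y : 0 <= y -> y <= r ->
    `|fine (polylog s x) - fine (polylog s y)| <= L * `|x - y|.
  move=> y0 yr; wlog xy : x y x0 xr y0 yr / y <= x => [H|].
    have [xy|/ltW xy] := leP y x; first exact: H.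
    by rewrite distrC [`|x - y|]distrC; exact: H.
  have le_xy : fine (polylog s y) <= fine (polylog s x).
    rewrite -lee_fin !fineK; first exact: polylog_le.
    - by rewrite polylog_fin_num// (le_lt_trans xr).
    - by rewrite polylog_fin_num// (le_lt_trans yr).
  by rewrite !ger0_norm ?subr_ge0// HL.
(* L may be 0, and e will be divided by the Lipschitz constant. *)
have L1 : 0 < L + 1 by rewrite ltr_wpDl.
apply/cvgrPdist_lt => e e0; near=> y.
have : `[0, r]%classic y by near: y; exact: withinT.
rewrite /= in_itv/= => /andP[y0 yr].
apply: (le_lt_trans (HL' y y0 yr)).
apply: (@le_lt_trans _ _ ((L + 1) * `|x - y|)).
  by rewrite ler_wpM2r// lerDl.
rewrite -ltr_pdivlMl// mulrC.
near: y; apply: cvg_within; apply: nbhsx_ballx; exact: divr_gt0.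
Unshelve. all: by end_near. Qed.

(** Intermediate value theorem between 0 and a point where the polylogarithm
exceeds [y]. *)
Lemma polylog_onto {R : realType} (s y : R) : 0 <= y -> (y%:E < polylog s 1)%E ->
  exists p, [/\ 0 <= p, p < 1 & polylog s p = y%:E].
Proof.
move=> y0 /polylog_lt_exists[r [r0 r1 yr]].
have rE : (fine (polylog s r))%:E = polylog s r by rewrite fineK ?polylog_fin_num.
have y_le : y <= fine (polylog s r) by rewrite -lee_fin rE ltW.
have [|p] := IVT r0 (polylog_continuous s r r0 r1) (v := y).
  by rewrite polylog0/= min_l ?max_r ?y0// (le_trans y0).
rewrite in_itv/= => /andP[p0 pr] <-; have p1 := le_lt_trans pr r1.
by exists p; split=> //; rewrite fineK ?polylog_fin_num.
Qed.

(** * Transfer to the distribution *)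

Lemma measurable_polylog {R : realType} (s : R) :
  measurable_fun (`[0, 1]%classic : set R) (polylog s).
Proof.
pose u k (p : R) := (p ^+ k / k%:R `^ s)%:E.
have u0 k p : (`[0, 1]%classic : set R) p -> (0 <= u k p)%E.
  by rewrite /= in_itv/= => /andP[p0 _]; rewrite lee_fin polylog_term_ge0.
apply: (eq_measurable_fun (fun p => \sum_(0 <= k <oo | k \in xpredT) u k.+1 p)%E).
  move=> p; rewrite inE => /u0 up0; rewrite /polylog -(nneseries_addn 1)//.
  by apply: eq_eseriesr => k _; rewrite addn1.
apply: ge0_emeasurable_sum => [k p /u0 //|k _].
apply/measurable_EFinP; apply: measurable_funM => //; exact: exprn_measurable.
Qed.

(** The two inclusions leave only the choice of whether [1] belongs to [A], and a
point has length 0. *)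
Lemma uniform_prob_co {R : realType} (A : set R) :
  `[0, 1[ `<=` A -> A `<=` `[0, 1] -> uniform_prob (@ltr01 R) A = 1%E.
Proof.
move=> coA Acc; have mU (D : set R) : measurable_fun D (fun x => (uniform_pdf 0 1 x)%:E).
  by apply/measurable_EFinP/measurable_funTS; exact: measurable_uniform_pdf.
have [A1|nA1] := pselect (A 1).
  have AE x : `[0, 1]%classic x -> A x.
    rewrite /= in_itv/= [x <= 1]le_eqVlt => /andP[x0 /predU1P[->//|x1]].
    by apply: coA; rewrite /= in_itv/= x0.
  exact: (integral_uniform_pdf1 ltr01 AE).
have -> : A = `[0, 1[%classic.
  apply/seteqP; split => // x Ax; have := Acc _ Ax; rewrite /= !in_itv/= => /andP[-> x1].
  by rewrite lt_neqAle x1 andbT; apply/eqP => x1E; apply: nA1; rewrite -x1E.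
by rewrite /uniform_prob integral_itv_bndo_bndc// integral_uniform_pdf1.
Qed.

Lemma uniform_prob_itv_gt0 {R : realType} (A : set R) (a b : R) : measurable A ->
  0 <= a -> a < b -> b <= 1 -> `[a, b] `<=` A -> (0 < uniform_prob (@ltr01 R) A)%E.
Proof.
move=> mA a0 ab b1 abA.
have : (uniform_prob (@ltr01 R) `[a, b] <= uniform_prob (@ltr01 R) A)%E.
  by rewrite le_measure// inE.
apply: lt_le_trans; rewrite /uniform_prob.
rewrite (eq_integral (cst 1%E)); last first.
  move=> x; rewrite inE/= in_itv/= => /andP[ax xb].
  by rewrite /uniform_pdf (le_trans a0 ax) (le_trans xb b1) subr0 invr1.
rewrite integral_cst// mul1e.
move: (lebesgue_measure_itv `[a, b]); rewrite /= lte_fin ab -EFinB => ->.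
by rewrite lte_fin subr_gt0.
Qed.

Lemma distribution_quantile {R : realType} {d : measure_display}
    {T : measurableType d} {P : probability T R} {Y : {RV P >-> R}}
    {Q : R -> \bar R} (hY : has_quantile_function Y Q) {A : set R} :
  measurable A -> distribution P Y A =
    uniform_prob (@ltr01 R) (`[0, 1] `&` Q @^-1` (EFin @` A)).
Proof.
move=> mA; rewrite -hY; last exact: measurable_image_EFin.
congr (P _); apply/seteqP; split => t /=; first by exists (Y t).
by case=> y Ay [<-].
Qed.

(** If the value at [p] were outside the closed set [C], then by continuity so
would be the values on an interval [p, b] with [p < b < 1]; this interval has
positive length, whereas the complement of [C] has probability 0. *)
Lemma quantile_support {R : realType} {s : R} {d : measure_display}
    {T : measurableType d} {P : probability T R} {Y : {RV P >-> R}}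
    (hY : has_quantile_function Y (polylog s)) (C : set R) (p : R) :
  closed C -> distribution P Y C = 1%E -> 0 <= p -> p < 1 ->
  C (fine (polylog s p)).
Proof.
move=> cC muC p0 p1; apply: contrapT => nCp.
have mC : measurable (~` C) by apply: open_measurable; exact: closed_openC.
pose A := `[0, 1]%classic `&` polylog s @^-1` (EFin @` ~` C).
have mB := measurable_image_EFin mC.
have mA : measurable A by apply: measurable_polylog.
have A0 : uniform_prob (@ltr01 R) A = 0%E.
  rewrite -(distribution_quantile hY mC).
  transitivity (1 - distribution P Y C)%E; last by rewrite muC subee.
  exact: (probability_setC (distribution P Y) (closed_measurable cC)).
pose r := (1 + p) / 2; have r0 : 0 <= r by rewrite /r; lra.
have r1 : r < 1 by rewrite /r; lra.
have pr : p < r by rewrite /r; lra.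
have /subspace_continuousP/(_ p) := polylog_continuous s r r0 r1.
rewrite /= in_itv/= p0 (ltW pr) => /(_ isT) cp.
have /cp : nbhs (fine (polylog s p)) (~` C).
  by apply: open_nbhs_nbhs; split => //; exact: closed_openC.
move=> /nbhs_ballP[e /= e0 He].
pose b := Num.min r (p + e / 2).
have pb : p < b by rewrite /b lt_min pr ltrDl divr_gt0.
have br : b <= r by rewrite /b ge_min lexx.
suff : (0 < uniform_prob (@ltr01 R) A)%E by rewrite A0 ltxx.
apply: (uniform_prob_itv_gt0 A p b) => //; first exact: ltW (le_lt_trans br r1).
move=> q /=; rewrite in_itv/= => /andP[pq qb].
have q0 := le_trans p0 pq; have qr := le_trans qb br.
have q1 := le_lt_trans qr r1.
split; first by rewrite /= in_itv/= q0 ltW.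
exists (fine (polylog s q)); last by rewrite fineK ?polylog_fin_num.
apply: He; last by rewrite /= in_itv/= q0.
rewrite /ball/= distrC ger0_norm ?subr_ge0// ltrBlDl.
apply: (le_lt_trans qb); rewrite /b gt_min; apply/orP; right; lra.
Qed.

Theorem mainTheorem1 (R : realType) (s : R)
    (d : measure_display) (T : measurableType d) (P : probability T R)
    (Y : {RV P >-> R}) (hY : has_quantile_function Y (polylog s)) :
  is_support (distribution P Y)
    (if 1 < s then `[0, zeta s]%classic else `[0, +oo[%classic).
Proof.
have SE : (if 1 < s then `[0, zeta s] else `[0, +oo[)%classic =
    [set y | 0 <= y /\ (y%:E <= polylog s 1)%E].
  case: ltP => s1; apply/seteqP; split => y /=; rewrite in_itv/=.
  - by move=> /andP[? ?]; rewrite polylog1_zeta.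
  - by rewrite polylog1_zeta// lee_fin => -[-> ->].
  - by rewrite andbT polylog1_pinfty// leey.
  - by case=> ->.
have cS : closed (if 1 < s then `[0, zeta s] else `[0, +oo[)%classic.
  by case: ifP => _; exact: itv_closed_ends_closed.
split => //.
  rewrite (distribution_quantile hY (closed_measurable cS)).
  apply: uniform_prob_co; last exact: subIsetl.
  move=> p /=; rewrite in_itv/= => /andP[p0 p1].
  split; first by rewrite /= in_itv/= p0 ltW.
  exists (fine (polylog s p)); last by rewrite fineK ?polylog_fin_num.
  rewrite SE /= fine_ge0 ?polylog_ge0// fineK ?polylog_fin_num//.
  by split => //; apply: polylog_le => //; exact: ltW.
move=> C cC muC; rewrite SE => y [y0].
(* Only the end point zeta s is not a value taken before 1; it is a left limit
   of such values, once it is known to be positive. *)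
have lt_in z : 0 <= z -> (z%:E < polylog s 1)%E -> C z.
  move=> z0 /(polylog_onto s z z0)[p [p0 p1 pz]].
  by have := quantile_support hY C p cC muC p0 p1; rewrite pz.
rewrite le_eqVlt => /predU1P[yE|]; last exact: lt_in.
have y_gt0 : 0 < y.
  (* The term k = 1 of the series equals 1. *)
  have : (\sum_(1 <= k < 2) (1 ^+ k / k%:R `^ s)%:E <= polylog s 1)%E.
    by apply: nneseries_lim_ge => k _ _; rewrite lee_fin polylog_term_ge0.
  by rewrite -yE big_nat1 powR1 divr1 lee_fin; exact: lt_le_trans.
apply: (@closed_cvg _ _ (y^'-) _ id C cC _ y); last first.
  by apply: cvg_at_left_filter; exact: cvg_id.
near=> z; apply: lt_in; first by near: z; exact: nbhs_left_ge.
by rewrite -yE lte_fin; near: z; exact: nbhs_left_lt.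
Unshelve. all: by end_near. Qed.
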